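(* Let $p$ be a prime and suppose that $G$ is a group of order $p^n$ and exponent $p^e$. Let $A \leq G$ be maximal (with respect to inclusion) among the normal abelian subgroups of $G$ having exponent $p^s$, where $s \geq 2$. If $|A| = p^r$ then \[ n \leq \frac{1}{2}(r - s + 1)(r - s + 2e - 2) + r, \] and thus \[ r \geq -\left(e - s + \tfrac12\right) + \sqrt{\left(e - s + \tfrac12\right)^2 + 2n}. \] *)

(* Defs.v *)
From HB Require Import structures.
From mathcomp Require Import all_boot all_order all_algebra all_fingroup all_solvable.

Set Implicit Arguments.
Unset Strict Implicit.
Unset Printing Implicit Defensive.

(* Main.v *)
(**
Let C be the centralizer of A.  By an argument of Alperin, maximality of A
forces every element of C of order dividing p^s to lie in A: a minimal
normal counterexample N inside C has a G-invariant maximal subgroup M containing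
[N, G] whose elements of order dividing p^s are central in C, and this suffices
to show that [x, g] lies in A whenever x in N has order dividing p^s; then
A<x> contradicts the maximality of A.

As s >= 2, the elements of C of order dividing p^2 are central, and this property
passes to the quotient by Ohm_1(C), whence |C : A| <= |Ohm_1(A)|^(e - s).
Finally A has k <= r - s + 1 generators, |Ohm_1(A)| = p^k, and choosing the
generators along a G-chief series of A bounds |G : C| by
p^((r - 1) + ... + (r - k)).
*)
Require Import Defs.
From mathcomp Require Import all_boot all_order all_algebra all_fingroup all_solvable.
From mathcomp Require Import zify lra.
Import GroupScope Order.TTheory GRing.Theory Num.Theory.

(** * Arithmetic of the bound on [n] *)

Lemma sum_subn_ord (k r : nat) :
  (k <= r)%N -> (2 * \sum_(i < k) (r - i.+1) + k * k.+1 = 2 * k * r)%N.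
Proof.
elim: k => [|k IHk] ltkr; first by rewrite big_ord0.
rewrite big_ord_recr /=; have := IHk (ltnW ltkr).
move: (\sum_(i < k) _)%N => t; rewrite -(subnKC ltkr) addKn; move: (r - _)%N => d.
lia.
Qed.

(** To be used with [d] = r - s, [f] = e - s and [t] the exponent bounding |G : C|. The bound on [n]
    grows with [k] up to [d.+1], so [k] = [d.+1] is the worst case. *)
Lemma order_bound_arith (n k s d f t : nat) :
  (2 <= s)%N -> (k <= d.+1)%N -> (2 * t + k * k.+1 = 2 * k * (s + d))%N ->
  (n <= s + d + k * f + t)%N ->
  (2 * n + 2 * d.+1 <= d.+1 * (d + 2 * (s + f)) + 2 * (s + d))%N.
Proof.
move=> s_ge2 le_kd sumE le_n.
have Dd : (d.+1 = k + (d.+1 - k))%N by rewrite subnKC.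
have Ds : (s = 2 + (s - 2))%N by rewrite subnKC.
move: (d.+1 - k)%N (s - 2)%N Dd Ds => c u Dd Ds.
have Dr : (s + d = u.+1 + (k + c))%N by lia.
suff: (2 * n + 3 * d.+1 <= d.+1 * (d.+1 + 2 * (s + f)) + 2 * (s + d))%N by lia.
rewrite {}Dr {}Dd {}Ds in sumE le_n *.
(* Once [n] is bounded, the slack is c^2 + 2cu + 2cf + c. *)
have := leq0n (c * c)%N; have := leq0n (c * u)%N; have := leq0n (c * f)%N.
lia.
Qed.

(** * p-groups whose elements of order dividing p^2 in a normal subgroup are central *)

Section CentralSocle.
Set Implicit Arguments.
Unset Strict Implicit.
Local Open Scope group_scope.

(* Induction to a maximal subgroup of C containing y, hence y^c, gives
   [y, y^c]^p = 1, so [y, y^c] is central; expanding (y^c)^p = y^p then shows that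
   [y, c] has order dividing p^2, so it is central too, and expanding again
   yields [y, c]^p = 1. *)
Lemma commg_expp1 (gT : finGroupType) (p : nat) (C M : {group gT}) (y c : gT) :
  p.-group C -> M <| C -> 'Ldiv_(p ^ 2)(M) \subset 'C(C) ->
  y \in M -> y ^+ p \in 'C(C) -> c \in C -> [~ y, c] ^+ p = 1.
Proof.
have [m] := ubnP #|C|; elim: m => // m IHm in C M c *.
move=> leCm pC nsMC cC2 My cCyp Cc; have [sMC nMC] := andP nsMC.
have Cy := subsetP sMC y My.
have sYC : <[y]> \subset C by rewrite cycle_subG.
have [eqC | [H maxH sYH]] := maximal_exists sYC.
  move: Cc; rewrite -eqC => /= /cycleP[i ->].
  by have /commgP/eqP->: commute y (y ^+ i); [apply/commuteX | rewrite expg1n].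
have nsHC := p_maximal_normal pC maxH; have [sHC nHC] := andP nsHC.
have Hy : y \in H by rewrite -cycle_subG.
set z := [~ y, c]; set t := [~ y, y ^ c].
have Myc : y ^ c \in M by rewrite memJ_norm ?(subsetP nMC).
have Mz : z \in M by rewrite /z commgEl groupM ?groupV.
have Dyc : y ^ c = y * z by rewrite /z commgEl mulKVg.
have Mt : t \in M by rewrite groupR.
have tp : t ^+ p = 1.
  apply: (IHm H (M :&: H)%G).
  - rewrite -ltnS; apply: leq_trans leCm.
    by rewrite ltnS proper_card // (maxgroupp maxH).
  - exact: pgroupS pC.
  - apply/andP; split; first exact: subsetIr.
    by rewrite normsI ?normG // (subset_trans sHC).
  - apply: subset_trans (centS sHC); apply: subset_trans cC2.
    by rewrite setSI // subsetIl.
  - by rewrite inE My.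
  - exact: subsetP (centS sHC) _ cCyp.
  - by rewrite memJ_norm ?(subsetP nHC).
have central w : w \in M -> w ^+ p ^+ p = 1 -> w \in 'C(C).
  by move=> Mw wp; apply: (subsetP cC2); apply/LdivP; rewrite expgM.
have /centP cCt: t \in 'C(C) by rewrite central // tp expg1n.
have Dt : [~ z, y] = t^-1.
  by rewrite -invgR /t Dyc commgMJ commgg conj1g mulg1.
have eqp : y ^+ p = (y ^ c) ^+ p.
  by rewrite -conjXg conjgE (centP cCyp) ?mulKg.
have zp : z ^+ p = t ^+ 'C(p, 2).
  have cz : commute z [~ z, y].
    by rewrite Dt; apply/commuteV/commute_sym/cCt/(subsetP sMC).
  have cy : commute y [~ z, y] by rewrite Dt; apply/commuteV/commute_sym/cCt.
  move: eqp; rewrite Dyc expMg_Rmul // Dt -mulgA -{1}[y ^+ p]mulg1 => /mulgI/esym.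
  by rewrite expgVn => /eqP; rewrite -eq_mulgV1 => /eqP.
have /centP cCz : z \in 'C(C) by rewrite central // zp -expgM mulnC expgM tp expg1n.
move: eqp; rewrite Dyc expgMn; last exact/commute_sym/cCz.
by rewrite -{1}[y ^+ p]mulg1 => /mulgI/esym.
Qed.

(** * Passage to the quotient by ['Ohm_1(M)] *)

Section Quotient.
Variables (gT : finGroupType) (p : nat) (C M : {group gT}).
Hypotheses (pC : p.-group C) (nsMC : M <| C).
Hypothesis cC2 : 'Ldiv_(p ^ 2)(M) \subset 'C(C).

Local Notation K := 'Ohm_1(M).

Lemma Ohm1_central : K \subset 'C(C).
Proof.
have sMC := normal_sub nsMC; rewrite (OhmE 1 (pgroupS sMC pC)) gen_subG.
apply: subset_trans cC2; apply/subsetP=> x /LdivP[Mx xp]; apply/LdivP.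
by rewrite expnS expgM -{1}(expn1 p) xp expg1n.
Qed.

Lemma Ohm1_Ldiv : K = 'Ldiv_p(M).
Proof.
have sMC := normal_sub nsMC; rewrite (OhmEabelian (pgroupS sMC pC)) ?expn1 //.
apply: subset_trans Ohm1_central (centS _).
exact: subset_trans (Ohm_sub 1 M) sMC.
Qed.

Lemma Ohm1_norm : C \subset 'N(K).
Proof. by apply: cents_norm; rewrite centsC Ohm1_central. Qed.

Lemma mem_quotient_Ldiv i y :
  y \in M -> (coset K y \in 'Ldiv_(p ^ i)(M / K)) = (y \in 'Ldiv_(p ^ i.+1)(M)).
Proof.
move=> My; have Cy := subsetP (normal_sub nsMC) y My.
have nKy : y \in 'N(K) by rewrite (subsetP Ohm1_norm).
apply/LdivP/LdivP; rewrite -morphX //= => -[_ yp].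
  have: y ^+ (p ^ i) \in K by apply: coset_idr; rewrite ?groupX.
  by rewrite Ohm1_Ldiv => /LdivP[_]; rewrite -expgM mulnC -expnS.
rewrite mem_quotient // coset_id // Ohm1_Ldiv; apply/LdivP.
by rewrite groupX // -expgM mulnC -expnS.
Qed.

(** This carries [cC2] through inductions modulo [K]: a lift y satisfies y^(p^3) = 1, so y^p is
    central and [commg_expp1] puts each [y, c] in [K]. *)
Lemma quotient_Ldiv2_central : 'Ldiv_(p ^ 2)(M / K) \subset 'C(C / K).
Proof.
apply/subsetP=> _ /[dup] /LdivP[/morphimP[y nKy My ->] _].
rewrite mem_quotient_Ldiv // => /LdivP[_ yp].
apply/centP=> _ /morphimP[c nKc Cc ->].
apply/commgP/eqP; rewrite -morphR //= coset_id // Ohm1_Ldiv.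
have [sMC nMC] := andP nsMC.
have Mz : [~ y, c] \in M by rewrite commgEl groupM ?groupV ?memJ_norm ?(subsetP nMC).
apply/LdivP; split=> //; apply: (commg_expp1 pC nsMC) => //.
by apply: (subsetP cC2); apply/LdivP; rewrite groupX // -expgM -expnS.
Qed.

End Quotient.

(** A weak form of regularity, to be applied with x y a conjugate of x. Induction on |C|: modulo
    ['Ohm_1(M)] the exponent [i] drops by one, and at [i] = 0 the element y turns out to be
    central. *)
Lemma expp_mul_Ldiv (gT : finGroupType) (p i : nat) (C M : {group gT}) (x y : gT) :
  p.-group C -> M <| C -> 'Ldiv_(p ^ 2)(M) \subset 'C(C) ->
  x \in C -> y \in M -> x ^+ p \in 'Ldiv_(p ^ i)(M) ->
  (x * y) ^+ p \in 'Ldiv_(p ^ i)(M) -> y ^+ p \in 'Ldiv_(p ^ i)(M).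
Proof.
have [m] := ubnP #|C|; elim: m => // m IHm in gT C M x y i *.
move=> leCm pC nsMC cC2 Cx My Mx Mxy; have [sMC nMC] := andP nsMC.
have Cy := subsetP sMC y My.
have [M1 | ntM] := eqsVneq M 1.
  move: My; rewrite M1 => /set1P->; rewrite expg1n.
  by apply/LdivP; rewrite expg1n group1.
pose K := 'Ohm_1(M)%G; have nKC : C \subset 'N(K) := Ohm1_norm pC nsMC cC2.
have ntK : K :!=: 1 by rewrite Ohm1_eq1.
have sKC : K \subset C := subset_trans (Ohm_sub 1 M) sMC.
have memQ j := @mem_quotient_Ldiv _ p C M pC nsMC cC2 j.
(* The predecessor is truncated: for [i] = 0 the quotient is also taken at exponent 0. *)
have up w : w \in M -> w \in 'Ldiv_(p ^ i)(M) -> w \in 'Ldiv_(p ^ i.-1.+1)(M).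
  move=> Mw; case: {+}i => // /LdivP[_ w1]; apply/LdivP.
  by split=> //; rewrite expn0 expg1 in w1; rewrite w1 expg1n.
have nKx : x \in 'N(K) by apply: (subsetP nKC).
have nKy : y \in 'N(K) by apply: (subsetP nKC).
have Mxp : x ^+ p \in M by case/LdivP: Mx.
have Mxyp : (x * y) ^+ p \in M by case/LdivP: Mxy.
have: coset K y ^+ p \in 'Ldiv_(p ^ i.-1)(M / K).
  apply: (IHm _ (C / K)%G (M / K)%G (coset K x)).
  - by rewrite -ltnS; apply: leq_trans leCm; rewrite ltnS ltn_quotient.
  - exact: quotient_pgroup.
  - exact: quotient_normal.
  - exact: quotient_Ldiv2_central.
  - exact: mem_quotient.
  - exact: mem_quotient.
  - by rewrite -morphX // memQ // up.
  - by rewrite -morphM // -morphX ?groupM // memQ // up.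
(* For positive [i] this is the goal. For [i] = 0 it only gives y^(p^2) = 1, but then y is central
   and (x y)^p = x^p y^p. *)
rewrite -morphX //= memQ ?groupX //; case: i => [|//] in Mx Mxy memQ up *.
case/LdivP=> _; rewrite /= expn1 => ypp.
have /centP cCy : y \in 'C(C).
  by apply: (subsetP cC2); apply/LdivP; rewrite expgM.
case/LdivP: Mx => _; case/LdivP: Mxy => _.
rewrite expn0 !expg1 expgMn; last exact/commute_sym/cCy.
by move=> + xp; rewrite xp mul1g => ->; apply/LdivP; rewrite expg1n group1.
Qed.

(** * Counting elements of bounded order *)

(** Induction on [e] through C / Ohm_1(C), whose own socle is no larger than Ohm_1(C): each further
    factor p of the exponent costs at most |Ohm_1(C)|. *)
Lemma card_leq_Ldiv (gT : finGroupType) (p e i : nat) (C : {group gT}) :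
  p.-group C -> 'Ldiv_(p ^ 2)(C) \subset 'C(C) ->
  exponent C %| p ^ e -> i <= e ->
  #|C| <= #|'Ldiv_(p ^ i)(C)| * #|'Ldiv_p(C)| ^ (e - i).
Proof.
elim: e i => [|e IHe] i in gT C *.
  move=> _ _; rewrite leqn0 expn0 dvdn1 => /eqP expC /eqP->.
  rewrite subn0 muln1 subset_leq_card //; apply/subsetP=> x Cx; apply/LdivP.
  by rewrite expn0 -expC expg_exponent.
move=> pC cC2 expC lei.
have [le_ei|ltei] := leqP e.+1 i.
  have ->: i = e.+1 by apply/eqP; rewrite eqn_leq lei.
  rewrite subnn muln1 subset_leq_card //; apply/subsetP=> x Cx; apply/LdivP.
  by split=> //; apply: (exponentP expC).
have nsCC := normal_refl C; pose K := 'Ohm_1(C)%G.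
have nKC : C \subset 'N(K) := Ohm1_norm pC nsCC cC2.
have sKC : K \subset C := Ohm_sub 1 C.
have K_Ldiv : K = 'Ldiv_p(C) :> {set gT} by exact: (Ohm1_Ldiv pC nsCC cC2).
have memQ j := @mem_quotient_Ldiv _ p C C pC nsCC cC2 j.
have cKC : K \subset 'C(C) := Ohm1_central pC nsCC cC2.
have quoLdiv j : 'Ldiv_(p ^ j)(C / K) = 'Ldiv_(p ^ j.+1)(C) / K.
  apply/setP=> xK; apply/idP/idP=> [|/morphimP[x nKx Ax ->]].
    move=> /[dup] /LdivP[/morphimP[x nKx Cx ->] _].
    by rewrite memQ //; apply: mem_morphim.
  by rewrite memQ //; case/LdivP: Ax.
(* As [K] is central and killed by p, the set on the left is a union of cosets of [K]. *)
have card_Ldiv j : #|'Ldiv_(p ^ j.+1)(C)| = (#|K| * #|'Ldiv_(p ^ j)(C / K)|)%N.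
  set A := 'Ldiv_(p ^ j.+1)(C).
  have nKA : A \subset 'N(K) by apply: subset_trans nKC; apply: subsetIl.
  have KA : K * A = A.
    apply/eqP; rewrite eqEsubset -{3}[A]mul1g mulSg ?sub1G // andbT.
    apply/subsetP=> _ /mulsgP[k x Kk /LdivP[Cx xp] ->]; apply/LdivP.
    have [Ck kp]: k \in C /\ k ^+ p = 1 by apply/LdivP; rewrite -K_Ldiv.
    split; first exact: groupM.
    rewrite expgMn ?xp; last exact: (centsP cKC).
    by rewrite expnS expgM kp expg1n mulg1.
  have covA : cover (rcosets K A) = A.
    apply/setP=> x; apply/bigcupP/idP=> [[_ /rcosetsP[y Ay ->]] | Ax].
      by rewrite -KA => /rcosetP[k Kk ->]; apply: mem_mulg.
    by exists (K :* x); [apply/rcosetsP; exists x | apply: rcoset_refl].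
  have: trivIset (rcosets K A).
    case/and3P: (rcosets_partition_mul C K) => _ + _; apply: trivIsetS.
    apply/subsetP=> _ /rcosetsP[x /LdivP[Cx _] ->]; apply/rcosetsP.
    by exists x.
  rewrite quoLdiv -/A card_quotient // /trivIset covA => /eqP <-.
  rewrite mulnC -sum_nat_const; apply: eq_bigr => _ /rcosetsP[x _ ->].
  exact: card_rcoset.
(* Ohm_2(C) is abelian, and its Ohm_1 and its p-th powers both lie in [K], so its order is at most
   |K|^2. *)
have le_socle : #|'Ldiv_p(C / K)| <= #|K|.
  pose B := 'Ohm_2(C)%G.
  have cBC : B \subset 'C(C) by rewrite /= (OhmE 2 pC) gen_subG.
  have cBB : abelian B by apply: subset_trans cBC (centS (Ohm_sub 2 C)).
  have B_Ldiv : B = 'Ldiv_(p ^ 2)(C) :> {set gT} by apply: OhmEabelian.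
  have pB := pgroupS (Ohm_sub 2 C) pC.
  rewrite -(leq_pmul2l (cardG_gt0 K)) -{1}(expn1 p) -card_Ldiv -B_Ldiv.
  rewrite -(mul_card_Ohm_Mho_abelian 1 cBB); apply: leq_mul; apply: subset_leq_card.
    exact: OhmS (Ohm_sub 2 C).
  rewrite (MhoE 1 pB) gen_subG; apply/subsetP=> _ /imsetP[x Bx ->].
  move: Bx; rewrite B_Ldiv K_Ldiv => /LdivP[Cx xp]; apply/LdivP.
  by rewrite groupX // expn1 -expgM.
have expCK : exponent (C / K) %| p ^ e.
  apply/exponentP=> _ /morphimP[x nKx Cx ->].
  rewrite -morphX //= coset_id // K_Ldiv; apply/LdivP.
  by rewrite groupX // -expgM mulnC -expnS (exponentP expC).
have IH := IHe i.-1 _ (C / K)%G (quotient_pgroup _ pC)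
  (quotient_Ldiv2_central pC nsCC cC2) expCK.
have le_i1 : i.-1 <= e by case: (i) ltei => //= j /ltnW.
have {}IH : #|C / K| <= #|'Ldiv_(p ^ i.-1)(C / K)| * #|K| ^ (e - i.-1).
  apply: leq_trans (IH le_i1) _; rewrite leq_mul //.
  by case: (e - i.-1) => // d; rewrite leq_exp2r.
have cardC : #|C| = (#|K| * #|C / K|)%N by rewrite card_quotient // Lagrange.
rewrite cardC; apply: leq_trans (leq_mul (leqnn _) IH) _; rewrite -K_Ldiv mulnA.
(* For [i] = 0 the exponent does not drop in the quotient; the factor |K| goes into the power [e.+1]
   instead. *)
case: i => [|i] in lei ltei le_i1 IH *; last by rewrite -card_Ldiv subSS.
rewrite /= !subn0 mulnAC -expnS mulnC leq_mul //.
apply: (@leq_trans 1).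
  have /subset_leq_card: 'Ldiv_(p ^ 0)(C / K) \subset [1].
    by apply/subsetP=> x /LdivP[_]; rewrite expn0 expg1 => ->; apply: set11.
  by rewrite cards1.
by rewrite card_gt0; apply/set0Pn; exists 1; apply/LdivP; rewrite group1 expg1n.
Qed.

(** * Alperin's argument *)

Lemma Ldiv_cent_max (gT : finGroupType) (p s : nat) (G A : {group gT}) :
  p.-group G -> 2 <= s ->
  [max A of B | [&& B <| G, abelian B & exponent B == (p ^ s)%N]] ->
  'Ldiv_(p ^ s)('C_G(A)) \subset A.
Proof.
move=> pG s_ge2 /maxgroupP[/and3P[nsAG cAA /eqP expA] maxA].
apply/negPn/negP => notCA; pose C := 'C_G(A)%G.
have [sAG nAG] := andP nsAG.
have nsCG : C <| G by rewrite /normal subsetIl normsI ?normG ?norms_cent.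
have pC := pgroupS (normal_sub nsCG) pG.
have cCA : A \subset 'C(C) by rewrite centsC subsetIr.
pose bad := [pred B : {group gT} |
  [&& B <| G, B \subset C & ~~ ('Ldiv_(p ^ s)(B) \subset A)]].
have [|N /mingroupP[/and3P[nsNG sNC notNA] minN] _] := @mingroup_exists _ bad C.
  by rewrite /bad /= nsCG subxx.
have [sNG nNG] := andP nsNG; have pN := pgroupS sNG pG.
have [x /LdivP[Nx xps] notAx] := subsetPn notNA.
have Cx := subsetP sNC x Nx.
(* N is nontrivial and G nilpotent, so [N, G] lies in a maximal subgroup M of N; containing [N, G]
   makes M invariant under G. *)
have prRN : [~: N, G] \proper N.
  apply: nil_comm_properl (pgroup_nil pG) sNG _ _; last by rewrite subsetI subxx.
  by apply: contraNneq notAx => N1; move: Nx; rewrite N1 => /set1P->.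
have [eqRN | [M maxM sRM]] := @maximal_exists _ [~: N, G]%G N (proper_sub prRN).
  by move: prRN; rewrite -{2}eqRN properxx.
have prMN := maxgroupp maxM; have sMN := proper_sub prMN.
have sMC := subset_trans sMN sNC; have sMG := subset_trans sMN sNG.
have nMG : G \subset 'N(M).
  by rewrite -commg_subl; apply: subset_trans sRM; apply: commSg.
have nsMC : M <| C by rewrite /normal sMC (subset_trans (normal_sub nsCG)).
have MA : 'Ldiv_(p ^ s)(M) \subset A.
  apply: contraTT prMN => notMA; rewrite (minN M) ?properxx //.
  by rewrite /bad /= /normal sMG nMG sMC.
have cC2 : 'Ldiv_(p ^ 2)(M) \subset 'C(C).
  apply: subset_trans cCA; apply: subset_trans MA; apply/subsetP=> w /LdivP[Mw wp].
  by apply/LdivP; split=> //; rewrite -(subnKC s_ge2) expnD expgM wp expg1n.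
(* x^p lies in the Frattini subgroup of N, hence in M. *)
have Mxp : x ^+ p \in 'Ldiv_(p ^ s)(M).
  apply/LdivP; split; last by rewrite -expgM mulnC expgM xps expg1n.
  apply: (subsetP (Phi_sub_max maxM)); rewrite (Phi_joing pN).
  apply: (subsetP (joing_subr _ _)); rewrite -{1}(expn1 p).
  by apply: Mho_p_elt => //; apply: mem_p_elt Nx.
have AxG g : g \in G -> [~ x, g] \in A.
  move=> Gg; set y := [~ x, g].
  have My : y \in M by apply: (subsetP sRM); apply: mem_commg.
  have Dxg : x * y = x ^ g by rewrite /y commgEl mulKVg.
  (* Both x^p and (x y)^p = (x^p)^g have order dividing p^s in M. *)
  have Myp : y ^+ p \in 'Ldiv_(p ^ s)(M).
    apply: (expp_mul_Ldiv pC nsMC cC2 Cx) => //; rewrite Dxg -conjXg.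
    case/LdivP: Mxp => Mxp xpps; apply/LdivP.
    by rewrite memJ_norm ?(subsetP nMG) // -conjXg xpps conj1g.
  have cyp : y ^+ p \in 'C(C) by apply: (subsetP cCA); apply: (subsetP MA).
  have tp : [~ y, x] ^+ p = 1 by apply: (commg_expp1 pC nsMC).
  set t := [~ y, x] in tp.
  have Cy := subsetP sMC y My.
  have /centP ct : t \in 'C(C).
    apply: (subsetP cC2); apply/LdivP; split; last by rewrite expgM tp expg1n.
    rewrite /t commgEl groupM ?groupV // memJ_norm //.
    by rewrite (subsetP nMG) ?(subsetP sNG).
  have s1 : (p ^ s = p * p ^ s.-1)%N by rewrite -expnS prednK // ltnW.
  apply: (subsetP MA); apply/LdivP; split=> //.
  (* Raise (x y)^p = x^p y^p t^C(p,2) to the power p^(s-1): since s >= 2 the factor t disappears,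
     leaving y^(p^s) = 1. *)
  have: (x ^ g) ^+ (p ^ s) = 1 by rewrite -conjXg xps conj1g.
  rewrite -Dxg {1}s1 expgM expMg_Rmul; try exact/commute_sym/ct.
  have c1 : commute (x ^+ p * y ^+ p) (t ^+ 'C(p, 2)).
    by apply/commute_sym/commuteM;
      apply/commuteX/commute_sym/commuteX/commute_sym/ct.
  have c2 : commute (x ^+ p) (y ^+ p).
    by apply/commute_sym; apply: (centP cyp); apply: groupX.
  rewrite -/t (expgMn _ c1) (expgMn _ c2) -!expgM -s1 xps mul1g mulnC expgM.
  have ->: t ^+ (p ^ s.-1) = 1 by rewrite -(subnKC s_ge2) /= expnS expgM tp expg1n.
  by rewrite expg1n mulg1.
pose B := (A <*> <[x]>)%G.
have cxA : <[x]> \subset 'C(A) by rewrite cycle_subG; case/setIP: Cx.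
have sxB : x \in B by rewrite -cycle_subG joing_subr.
have sAB : A \subset B := joing_subl _ _.
have nsBG : B <| G.
  rewrite /normal join_subG sAG cycle_subG (subsetP sNG) //=.
  apply/subsetP=> g Gg; rewrite inE conjYg (normsP nAG) // join_subG sAB /=.
  by rewrite -cycleJ cycle_subG conjg_mulR groupM // (subsetP sAB) ?AxG.
have cBB : abelian B by rewrite /= abelianY cAA cycle_abelian.
have expB : exponent B = (p ^ s)%N.
  apply/eqP; rewrite eqn_dvd -{2}expA exponentS // andbT.
  apply/exponentP=> b; rewrite /= cent_joinEr // => /mulsgP[a _ Aa /cycleP[i ->] ->].
  rewrite expgMn; last exact/commuteX/(centsP cCA)/Cx.
  by rewrite -expA (expg_exponent Aa) expA mul1g -expgM mulnC expgM xps expg1n.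
by move: notAx; rewrite -(maxA B) ?sxB // nsBG cBB expB eqxx.
Qed.

(** * Index of a centralizer *)

(** Take M of index p in V containing [V, G]. The conjugates of an element a outside M lie in the
    coset a M, so there are at most |M| of them; the rest of [S] is moved into M by powers of a, and
    induction applies to M. *)
Lemma index_cent_leq (gT : finGroupType) (p r : nat) (G V : {group gT}) (S : seq gT) :
  prime p -> p.-group G -> V <| G -> #|V| = (p ^ r)%N -> {subset S <= V} ->
  #|G : 'C_G([set x in S])| <= p ^ (\sum_(i < size S) (r - i.+1)).
Proof.
move=> p_pr pG; elim: r V S => [|r IHr] V S nsVG oV sSV.
  have V1 : V :=: 1 by apply: card1_trivg.
  have ->: 'C_G([set x in S]) = G.
    apply/setIidPl/centsP=> g _ x; rewrite inE => /sSV; rewrite V1 => /set1P->.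
    exact: commute1.
  by rewrite indexgg expn_gt0 prime_gt0.
have [sVG nVG] := andP nsVG; have pV := pgroupS sVG pG.
have prRV : [~: V, G] \proper V.
  apply: nil_comm_properl (pgroup_nil pG) sVG _ _; last by rewrite subsetI subxx.
  by rewrite -cardG_gt1 oV -(exp1n r.+1) ltn_exp2r ?prime_gt1.
have [eqRV | [M maxM sRM]] := @maximal_exists _ [~: V, G]%G V (proper_sub prRV).
  by move: prRV; rewrite -{2}eqRV properxx.
have prMV := maxgroupp maxM; have sMV := proper_sub prMV.
have nsMG : M <| G.
  rewrite /normal (subset_trans sMV) //= -commg_subl.
  by apply: subset_trans sRM; apply: commSg.
have oM : #|M| = (p ^ r)%N.
  apply/eqP; rewrite -(eqn_pmul2r (prime_gt0 p_pr)) -expnSr -oV.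
  by rewrite -(p_maximal_index pV maxM) Lagrange.
have [sSM | /allPn[a Sa notMa]] := boolP (all (mem M) S).
  apply: leq_trans (IHr M S nsMG oM (allP sSM)) _.
  by rewrite leq_exp2l ?prime_gt1 // leq_sum // => i _; rewrite leq_sub2r.
(* [f] keeps the M-part of an element of V = M<a>; centralizing a and these parts centralizes
   [S]. *)
pose f := divgr M <[a]>; pose S' := map f (rem a S).
have Va := sSV a Sa.
have MaV : M * <[a]> = V.
  by apply: mulg_normal_maximal; rewrite ?cycle_subG // (p_maximal_normal pV).
have sSM : {subset S' <= M}.
  move=> _ /mapP[x /mem_rem/sSV Vx ->].
  by apply: mem_divgr; rewrite MaV.
have sizeS : size S = (size S').+1.
  by rewrite size_map size_rem // prednK //; case: (S) Sa.
have cap : 'C_G[a] :&: 'C_G([set x in S']) \subset 'C_G([set x in S]).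
  apply/subsetP=> g /setIP[/setIP[Gg cga] /setIP[_ /centP cgS']].
  rewrite inE Gg; apply/centP=> x; rewrite inE => Sx.
  have [-> | neq_xa] := eqVneq x a; first exact/cent1P.
  have Sax : x \in rem a S.
    by move: Sx; rewrite (perm_mem (perm_to_rem Sa)) inE (negPf neq_xa).
  rewrite (divgr_eq M <[a]> x); apply: commuteM.
    by apply: cgS'; rewrite inE map_f.
  have: remgr M <[a]> x \in <[a]> by apply: mem_remgr; rewrite MaV sSV.
  by case/cycleP=> i ->; apply/commuteX/cent1P.
have index_a : #|G : 'C_G[a]| <= p ^ r.
  rewrite index_cent1 -oM -(card_lcoset M a) subset_leq_card //.
  apply/subsetP=> _ /imsetP[g Gg ->]; apply/lcosetP; exists [~ a, g].
    by apply: (subsetP sRM); apply: mem_commg.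
  by rewrite conjg_mulR.
have := IHr M S' nsMG oM sSM; rewrite sizeS big_ord_recl subSS subn0 expnD.
move=> /(leq_mul index_a); apply: leq_trans.
have le_cap := dvdn_leq (indexg_gt0 _ _) (indexgS G cap).
apply: leq_trans le_cap _.
rewrite -(@Lagrange_index _ G 'C_G[a]%G) ?subsetIl // leq_mul2l; apply/orP; right.
rewrite indexgI subset_leq_card //.
apply/subsetP=> _ /rcosetsP[g /setIP[Gg _] ->]; apply/rcosetsP.
by exists g.
Qed.

End CentralSocle.

(** * Combining the bounds on |C| and |G : C| *)

Local Open Scope ring_scope.

Theorem theorem3 (R : rcfType) (gT : finGroupType) (G A : {group gT})
    (p n e s r : nat)
    (p_prime : prime p)
    (oG : #|G| = (p ^ n)%N)
    (expG : exponent G = (p ^ e)%N)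
    (s_ge2 : (2 <= s)%N)
    (maxA : [max A of B | [&& B <| G, abelian B & exponent B == (p ^ s)%N]])
    (oA : #|A| = (p ^ r)%N) :
  n%:R <= 1 / 2 * (r%:R - s%:R + 1) * (r%:R - s%:R + 2 * e%:R - 2) + r%:R :> R
  /\
  r%:R >= - (e%:R - s%:R + 1 / 2)
          + Num.sqrt ((e%:R - s%:R + 1 / 2) ^+ 2 + 2 * n%:R) :> R.
Proof.
have pG : p.-group G by rewrite /pgroup oG pnatX pnat_id.
have socle := Ldiv_cent_max pG s_ge2 maxA.
have /maxgroupP[/and3P[nsAG cAA /eqP expA] _] := maxA.
have [sAG nAG] := andP nsAG; have pA := pgroupS sAG pG.
have p_gt1 := prime_gt1 p_prime.
pose k := 'm(A)%g; pose C := 'C_G(A)%G.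
have nsCG : (C <| G)%g by rewrite /normal subsetIl normsI ?normG ?norms_cent.
have sCG := normal_sub nsCG; have pC := pgroupS sCG pG.
have sAC : A \subset C by rewrite subsetI sAG.
have le_se : (s <= e)%N.
  by rewrite -(dvdn_Pexp2l _ _ p_gt1) -expA -expG exponentS.
have oOhm : #|'Ohm_1(A)%g| = (p ^ k)%N.
  rewrite /k grank_abelian // (rank_pgroup pA) (p_rank_abelian _ cAA).
  by rewrite -p_part part_pnat_id //; apply: pgroupS (Ohm_sub 1 A) pA.
(* |A| = |Ohm_1(A)| |Mho^1(A)|, and Mho^1(A) contains the p-th power of an element of order p^s. *)
have le_k : (k + s.-1 <= r)%N.
  have [a Aa expAa] := exponent_witness (pgroup_nil pA).
  rewrite -(leq_exp2l _ _ p_gt1) -oA expnD -oOhm -(mul_card_Ohm_Mho_abelian 1 cAA).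
  rewrite leq_mul2l; apply/orP; right.
  have /subset_leq_card: (<[a ^+ (p ^ 1)]> \subset 'Mho^1(A))%g.
    by rewrite cycle_subG Mho_p_elt // (mem_p_elt pA).
  apply: leq_trans; rewrite -orderE expn1 orderXdiv -expAa expA.
    by rewrite -{2}(prednK (ltnW s_ge2)) expnS mulKn // prime_gt0.
  by rewrite -{1}(expn1 p) dvdn_exp2l // ltnW.
have leC : (#|C| <= p ^ (r + k * (e - s)))%N.
  have cC2 : ('Ldiv_(p ^ 2)(C) \subset 'C(C))%g.
    apply: (@subset_trans _ _ A); last by rewrite centsC subsetIr.
    apply: subset_trans socle; apply/subsetP=> w /LdivP[Cw wp].
    by apply/LdivP; split=> //; rewrite -(subnKC s_ge2) expnD expgM wp expg1n.
  have expC : (exponent C %| p ^ e)%N by rewrite -expG exponentS.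
  apply: leq_trans (card_leq_Ldiv pC cC2 expC le_se) _.
  rewrite expnD expnM -oA -oOhm leq_mul ?(subset_leq_card socle) //.
  have sLO : ('Ldiv_p(C) \subset 'Ohm_1(A))%g.
    apply/subsetP=> w /LdivP[Cw wp]; rewrite (OhmE 1 pA) mem_gen //; apply/LdivP.
    rewrite expn1 wp; split=> //; apply: (subsetP socle); apply/LdivP; split=> //.
    by rewrite -(subnKC s_ge2) expnS expgM wp expg1n.
  by case: (e - s)%N => // d; rewrite leq_exp2r ?subset_leq_card.
have leGC : (#|G : C| <= p ^ (\sum_(i < k) (r - i.+1)))%N.
  (* A generating set of [k] elements has the same centralizer as A. *)
  have [B genB oB] := grank_witness A.
  have sBA : {subset enum B <= A}.
    by move=> b; rewrite mem_enum -genB; apply: mem_gen.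
  have := index_cent_leq p_prime pG nsAG oA sBA; rewrite -cardE oB.
  by rewrite set_enum -cent_gen genB.
have le_n : (n <= r + k * (e - s) + \sum_(i < k) (r - i.+1))%N.
  rewrite -(leq_exp2l _ _ p_gt1) -oG -(Lagrange sCG) expnD; exact: leq_mul.
have sumE : (2 * \sum_(i < k) (r - i.+1) + k * k.+1 = 2 * k * r)%N.
  by apply: sum_subn_ord; apply: leq_trans le_k; apply: leq_addr.
have le_sr : (s <= r)%N.
  by rewrite -(leq_exp2l _ _ p_gt1) -oA -expA dvdn_leq ?exponent_dvdn.
have [d Dr] : {d | r = s + d}%N by exists (r - s)%N; rewrite subnKC.
have le_kd : (k <= d.+1)%N.
  by rewrite -(leq_add2r s.-1) (leq_trans le_k) // Dr addSnnS prednK 1?addnC // ltnW.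
(* Twice the claimed bound, with the negative term moved to the left to stay in the naturals. *)
have le_n2 : (2 * n + 2 * d.+1 <= d.+1 * (d + 2 * e) + 2 * r)%N.
  rewrite Dr in le_n sumE *; rewrite -(subnKC le_se).
  exact: order_bound_arith s_ge2 le_kd sumE le_n.
have key : 2 * n%:R <=
    (r%:R - s%:R + 1) * (r%:R - s%:R + 2 * e%:R - 2) + 2 * r%:R :> R.
  move: le_n2; rewrite -(ler_nat R) Dr -addn1 !(natrD, natrM); nra.
split; first by lra.
have les : s%:R <= e%:R :> R by rewrite ler_nat.
have lesr : s%:R <= r%:R :> R by rewrite ler_nat.
have s2 : 2 <= s%:R :> R by rewrite ler_nat.
suff: Num.sqrt ((e%:R - s%:R + 1 / 2) ^+ 2 + 2 * n%:R)
        <= r%:R + (e%:R - s%:R + 1 / 2) :> R by lra.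
rewrite -[leRHS]ger0_norm -?sqrtr_sqr; last by lra.
(* After squaring, the right side exceeds the left by at least (s - 1)(2e - s - 2), which is
   nonnegative as e >= s >= 2. *)
by rewrite ler_wsqrtr //; nra.
Qed.
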